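(* Let $T$ be a tree with radius $rad(T)$. Then $vcfc(T)\le rad(T)+1$. Moreover, the bound is sharp: every star $T$ of order at least two satisfies $vcfc(T)=2=rad(T)+1$.
   Context: The eccentricity of a vertex $v$ is the maximum distance from $v$ to the other vertices; the radius $rad(G)$ is the minimum eccentricity over all vertices. Vertex-colorings are arbitrary, not necessarily proper. A path in a vertex-colored graph is called conflict-free if there is a color used on exactly one of its vertices. A vertex-colored graph is conflict-free vertex-connected if any two vertices of the graph are connected by a conflict-free path. For a connected graph $G$, the conflict-free vertex-connection number $vcfc(G)$ is the smallest number of colors needed in a vertex-coloring of $G$ that makes $G$ conflict-free vertex-connected. *)

(* Defs.v *)
From HB Require Import structures.
From mathcomp Require Import all_boot.
From mathcomp Require Import boolp.

Set Implicit Arguments.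
Unset Strict Implicit.
Unset Printing Implicit Defensive.

(** [nat_min P] is the least natural number satisfying [P]; it is the junk
    value 0 when there is none. *)
Definition nat_min (P : nat -> Prop) : nat :=
  if pselect (exists n, `[< P n >]) is left exP then ex_minn exP else 0.

Lemma nat_minP (P : nat -> Prop) :
  (exists n, P n) -> P (nat_min P) /\ (forall m, P m -> nat_min P <= m).
Proof.
move=> [n Pn]; rewrite /nat_min; case: pselect => [exP | []]; last first.
  by exists n; apply/asboolP.
case: ex_minnP => m /asboolP Pm min_m; split=> // k Pk.
by apply: min_m; apply/asboolP.
Qed.

Record sgraph := SGraph {
  vertex :> finType;
  adj : rel vertex;
  adj_sym : symmetric adj;
  adj_irrefl : irreflexive adj
}.

Definition connected (G : sgraph) : Prop :=
  forall x y : G, connect (@adj G) x y.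

Definition acyclic (G : sgraph) : Prop :=
  forall s : seq G, 2 < size s -> ~ ucycle (@adj G) s.

Definition is_tree (G : sgraph) : Prop :=
  [/\ 0 < #|G|, connected G & acyclic G].

(** A star is a graph K_{1,m}: one part of the bipartition is [{z}], and every
    other vertex is joined to [z] and to nothing else. *)
Definition is_star (G : sgraph) : Prop :=
  exists z : G, forall x y : G, adj x y = ((x == z) != (y == z)).

Definition dist (G : sgraph) (x y : G) : nat :=
  nat_min (fun n => exists p : seq G,
    [/\ path (@adj G) x p, last x p = y & size p = n]).

(** The term [u = v] contributes 0 and hence does not affect the maximum. *)
Definition ecc (G : sgraph) (v : G) : nat := \max_(u : G) dist v u.

Definition rad (G : sgraph) : nat :=
  nat_min (fun n => exists v : G, ecc v = n).

(** [conflict_free c s]: some color occurs on exactly one entry of [s], the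
    list of vertices of a path. *)
Definition conflict_free (G : sgraph) (k : nat) (c : G -> 'I_k) (s : seq G)
    : Prop :=
  exists i : 'I_k, count (fun v => c v == i) s = 1.

(** The path from [x] to [y] is [x :: p], without repeated vertices. *)
Definition conflict_free_connected (G : sgraph) (k : nat) (c : G -> 'I_k)
    : Prop :=
  forall x y : G, x != y -> exists p : seq G,
    [/\ path (@adj G) x p, last x p = y, uniq (x :: p)
      & conflict_free c (x :: p)].

Definition vcfc (G : sgraph) : nat :=
  nat_min (fun k => exists c : G -> 'I_k, conflict_free_connected c).

Lemma distP (G : sgraph) (x y : G) : connected G ->
  (exists p, [/\ path (@adj G) x p, last x p = y & size p = dist x y]) /\
  (forall p, path (@adj G) x p -> last x p = y -> dist x y <= size p).
Proof.
move=> /(_ x y)/connectP[p xp yp].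
have /nat_minP[? min_d] : exists n, exists p : seq G,
    [/\ path (@adj G) x p, last x p = y & size p = n].
  by exists (size p), p.
by split=> // q xq yq; apply: min_d; exists q.
Qed.

Lemma radP (G : sgraph) : 0 < #|G| ->
  (exists v : G, ecc v = rad G) /\ (forall v : G, rad G <= ecc v).
Proof.
move=> /card_gt0P[v0 _].
have /nat_minP[? min_r] : exists n, exists v : G, ecc v = n.
  by exists (ecc v0), v0.
by split=> // v; apply: min_r; exists v.
Qed.

(** In a connected graph the coloring with pairwise distinct colors works, so
    the minimum defining [vcfc] exists. *)
Lemma vcfcP (G : sgraph) : connected G ->
  (exists c : G -> 'I_(vcfc G), conflict_free_connected c) /\
  (forall k (c : G -> 'I_k), conflict_free_connected c -> vcfc G <= k).
Proof.
move=> cG.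
have /nat_minP[? min_c] :
    exists k, exists c : G -> 'I_k, conflict_free_connected c.
  exists #|G|, (@enum_rank G) => x y _.
  have /connectP[p xp yp] := cG x y.
  move: yp; case/shortenP: xp => q xq uq _ yq.
  exists q; split=> //; exists (enum_rank x).
  rewrite (eq_count (a2 := pred1 x)) ?count_uniq_mem ?mem_head //.
  by move=> v /=; rewrite (inj_eq enum_rank_inj).
by split=> // k c cc; apply: min_c; exists c.
Qed.

Lemma star_is_tree (G : sgraph) : is_star G -> is_tree G.
Proof.
move=> [z adjE]; split; first by apply/card_gt0P; exists z.
  have cz x : connect (@adj G) x z.
    case: (eqVneq x z) => [-> //|xz]; apply: connect1.
    by rewrite adjE eqxx (negPf xz).
  have zc x : connect (@adj G) z x.
    by rewrite (sym_connect_sym (@adj_sym G)).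
  by move=> x y; apply: connect_trans (cz x) (zc y).
move=> [|a [|b [|c s]]] // _ /andP[/= /and3P[ab bc cs]].
rewrite !inE !negb_or => /andP[/and3P[nab nac _] /andP[/andP[nbc bs] _]].
have bz : b = z.
  apply/eqP; apply: contraNT nac => nbz; move: ab bc; rewrite !adjE.
  by rewrite (negPf nbz); case: (a =P z) => // ->; case: (c =P z) => // ->.
subst b; case: s cs bs => [|d s] /= /andP[]; rewrite adjE.
  by rewrite (eq_sym c) (negPf nbc) (negPf nab).
rewrite (eq_sym c) (negPf nbc) => + _; rewrite inE (eq_sym d).
by case: (z == d).
Qed.

(* Main.v *)
Require Import Defs.
From mathcomp Require Import all_boot.

(** Color each vertex by its distance to a center [r]. In a breadth-first tree
    rooted at [r], the path from [x] to [y] climbs to the lowest common ancestor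
    and then descends, so the color of that ancestor, the smallest color on the
    path, occurs only once. *)

Set Implicit Arguments.
Unset Strict Implicit.
Unset Printing Implicit Defensive.

Section Distance.
Variables (G : sgraph) (cG : connected G).
Implicit Types x y v : G.

Lemma dist_xx x : dist x x = 0.
Proof. by apply/eqP; rewrite -leqn0; apply: ((distP x x cG).2 [::]). Qed.

Lemma dist_eq0 x y : dist x y = 0 -> x = y.
Proof.
have [[p [_ <- <-]] _] := distP x y cG.
by move/eqP; rewrite size_eq0 => /eqP->.
Qed.

(** The vertex before [y] on a shortest path from [x] serves as the parent of [y] in a breadth-first
    tree rooted at [x]. *)
Lemma dist_pred x y : x != y -> exists2 u, adj u y & dist x u < dist x y.
Proof.
have [[p [xp yp <-]] _] := distP x y cG.
case/lastP: p xp yp => [_ /= -> | q z]; first by rewrite eqxx.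
rewrite rcons_path last_rcons size_rcons => /andP[xq qz] zy _; subst z.
by exists (last x q) => //; apply: (distP x _ cG).2.
Qed.

Lemma leq_dist_ecc x y : dist x y <= ecc x.
Proof. exact: leq_bigmax. Qed.

Lemma rad_gt0 : 1 < #|G| -> 0 < rad G.
Proof.
move=> /card_gt1P[x [y [_ _ xy]]].
have /radP[[v vE] _] : 0 < #|G| by apply/card_gt0P; exists x.
rewrite lt0n -vE; apply: contraNneq xy => v0.
have vP u : v = u by apply/dist_eq0/eqP; rewrite -leqn0 -v0 leq_dist_ecc.
by rewrite -(vP x) -(vP y).
Qed.

(** With a single color, a conflict-free path can have only one vertex, so it cannot join two
    distinct vertices. *)
Lemma vcfc_gt1 : 1 < #|G| -> 1 < vcfc G.
Proof.
move=> /card_gt1P[x [y [_ _ xy]]].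
have [[c cc] _] := vcfcP cG.
have [p [_ yp _ [i ci]]] := cc x y xy.
rewrite ltnNge; apply: contra xy => k1.
have c_const v : c v == i.
  apply/eqP/val_inj => /=.
  have /= := leq_trans (ltn_ord (c v)) k1; have /= := leq_trans (ltn_ord i) k1.
  by rewrite !ltnS !leqn0 => /eqP-> /eqP->.
move: ci; rewrite (eq_count (a2 := predT)) // count_predT /= => -[].
by move/size0nil=> p0; rewrite -yp p0.
Qed.

(* The third clause makes the induction go through: it guarantees that the
   deeper endpoint is not already on the path from its predecessor. *)
Lemma path_unique_min r x y : exists p m,
  [/\ path (@adj G) x p, last x p = y, uniq (x :: p),
      forall v, v \in x :: p ->
        [|| v == x, v == y, dist r v < dist r x | dist r v < dist r y]
    & m \in x :: p /\
      forall v, v \in x :: p -> v != m -> dist r m < dist r v].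
Proof.
(* Induction on the sum of the depths: the deeper endpoint is replaced by its parent [u], and the
   path obtained is extended back by one edge. *)
have [n] := ubnP (dist r x + dist r y); elim: n x y => // n IHn x y.
rewrite ltnS => len.
have [<- | xy] := eqVneq x y.
  exists [::], x; split=> // [v | ]; first by rewrite inE => ->.
  by split=> [|v]; rewrite inE // => ->.
have [le_yx | lt_xy] := leqP (dist r y) (dist r x).
  have rx : r != x.
    apply: contraNneq xy => rx; subst r; apply/eqP/dist_eq0/eqP.
    by rewrite -leqn0 -(dist_xx x).
  have [u ux lt_u] := dist_pred rx.
  have [|p [m [up yp Up bp [mp min_m]]]] := IHn u y.
    by apply: leq_trans len; rewrite ltn_add2r.
  (* If [x] were on the path, it would be [u] or [y], or strictly closer to [r] than one of them;
     but [x] is deeper than [u] and at least as deep as [y]. *)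
  have xNp : x \notin u :: p.
    apply/negP => /bp; rewrite (negPf xy) !ltnNge le_yx (ltnW lt_u) !orbF.
    by move=> /eqP xu; rewrite xu ltnn in lt_u.
  exists (u :: p), m; split=> //.
  - by rewrite /= adj_sym ux.
  - by rewrite cons_uniq xNp.
  - move=> v; rewrite inE => /predU1P[->|]; first by rewrite eqxx.
    case/bp/or4P => [/eqP-> | -> | lt_vu | ->]; rewrite ?orbT //.
      by rewrite lt_u !orbT.
    by rewrite (ltn_trans lt_vu lt_u) !orbT.
  - split=> [|v]; first by rewrite inE mp orbT.
    rewrite inE => /predU1P[-> _|]; last exact: min_m.
    (* The minimum stays unique: [x] is deeper than [u], which is [m] itself or deeper than [m]. *)
    have [um | um] := eqVneq u m; first by rewrite -um.
    by apply: ltn_trans lt_u; rewrite min_m ?mem_head.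
(* Symmetric case: [y] is strictly deeper, so the path is extended at its far end. *)
have ry : r != y by apply: contraTneq lt_xy => ->; rewrite dist_xx.
have [u uy lt_u] := dist_pred ry.
have [|p [m [xp up Up bp [mp min_m]]]] := IHn x u.
  by apply: leq_trans len; rewrite ltn_add2l.
have uxp : u \in x :: p by rewrite -up mem_last.
have yNp : y \notin x :: p.
  apply/negP => /bp; rewrite eq_sym (negPf xy) !ltnNge (ltnW lt_xy).
  rewrite (ltnW lt_u) !orbF.
  by move=> /eqP yu; rewrite yu ltnn in lt_u.
exists (rcons p y), m; rewrite -rcons_cons; split.
- by rewrite rcons_path xp up.
- by rewrite last_rcons.
- by rewrite rcons_uniq yNp.
- move=> v; rewrite mem_rcons inE => /predU1P[->|]; first by rewrite eqxx orbT.
  case/bp/or4P => [-> // | /eqP-> | -> | lt_vu]; rewrite ?orbT //.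
    by rewrite lt_u !orbT.
  by rewrite (ltn_trans lt_vu lt_u) !orbT.
- split=> [|v]; first by rewrite mem_rcons inE mp orbT.
  rewrite mem_rcons inE => /predU1P[-> _|]; last exact: min_m.
  have [um | um] := eqVneq u m; first by rewrite -um.
  by apply: ltn_trans lt_u; rewrite min_m.
Qed.

Lemma vcfc_le_rad : 0 < #|G| -> vcfc G <= rad G + 1.
Proof.
move=> /radP[[r rE] _]; rewrite addn1.
(* Since [r] has eccentricity [rad G], depths lie between 0 and [rad G]; these are [rad G + 1]
   values, on which [inord] is injective. *)
apply: (vcfcP cG).2 (fun v => inord (dist r v) : 'I_(rad G).+1) _ => x y _.
have [p [m [xp yp Up _ [mp min_m]]]] := path_unique_min r x y.
exists p; split=> //; exists (inord (dist r m)).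
rewrite (eq_in_count (a2 := pred1 m)) ?count_uniq_mem ?mp // => v vp /=.
rewrite -val_eqE /= !inordK ?ltnS -?rE ?leq_dist_ecc //.
have [-> | vm] := eqVneq v m; first by rewrite eqxx.
by rewrite gtn_eqF // min_m.
Qed.

End Distance.

(** The center of the star has eccentricity at most 1. *)
Lemma rad_star (G : sgraph) : is_star G -> rad G <= 1.
Proof.
move=> sG; have [G0 cG _] := star_is_tree sG; case: sG => z adjE.
apply: leq_trans ((radP G0).2 z) _; apply/bigmax_leqP => u _.
have [-> | uz] := eqVneq u z; first by rewrite dist_xx.
by apply: ((distP z u cG).2 [:: u]); rewrite //= adjE eqxx (negPf uz).
Qed.

Theorem theorem7 :
  (forall T : sgraph, is_tree T -> vcfc T <= rad T + 1) /\
  (forall T : sgraph, is_star T -> 2 <= #|T| ->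
     vcfc T = 2 /\ 2 = rad T + 1).
Proof.
split=> [T [T0 cT _] | T sT T2]; first exact: vcfc_le_rad.
have [T0 cT _] := star_is_tree sT.
have rad1 : rad T = 1 by apply/eqP; rewrite eqn_leq rad_star ?rad_gt0.
split; last by rewrite rad1.
apply/eqP; rewrite eqn_leq vcfc_gt1 // andbT.
by have := vcfc_le_rad cT T0; rewrite rad1.
Qed.
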